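(* Let $p$ be an odd prime and let $m$ be an integer not divisible by $p$. For $n\in\mathbb{N}$ let $S_n=\sum_{k=0}^n\binom nk\binom{n+k}k\frac1{k+1}$ be the $n$th Schröder number. Then $$\sum_{k=1}^{p-1}\frac{S_k}{m^k}\equiv\frac{m^2-6m+1}{2m}\left(1-\left(\frac{m^2-6m+1}p\right)\right)\pmod p.$$
   Context: $\left(\frac{\cdot}{p}\right)$ denotes the Legendre symbol (equal to $0$ on multiples of $p$). Congruences between rationals modulo $p$ are understood in the ring of rationals with denominators prime to $p$. *)

(* Defs.v *)
From mathcomp Require Import all_boot all_order all_algebra.

Set Implicit Arguments.
Unset Strict Implicit.
Unset Printing Implicit Defensive.

Import Order.TTheory GRing.Theory Num.Theory.
Local Open Scope ring_scope.

Definition schroeder (n : nat) : rat :=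
  \sum_(0 <= k < n.+1) 'C(n, k)%:R * 'C(n + k, k)%:R * (1 / k.+1%:R).

(* Meaningful only for p an odd prime. *)
Definition legendre (a : int) (p : nat) : int :=
  if (p %| a)%Z then 0
  else if [exists x : 'I_p, (x%:Z ^+ 2 == a %[mod p])%Z] then 1
  else -1.

Definition p_integral (p : nat) (x : rat) : bool := coprime `|denq x|%N p.

(* x and y lie in the subring of p-integral rationals, and x - y lies in the
   ideal generated by p in that subring. *)
Definition rat_eqmod (p : nat) (x y : rat) : Prop :=
  [/\ p_integral p x, p_integral p y
    & exists2 z : rat, p_integral p z & x - y = p%:R * z].

(* Main.v *)
Require Import Defs.
From mathcomp Require Import all_boot all_order all_algebra.
From mathcomp Require Import cyclic finfield.
From mathcomp Require Import ring zify.

Import Order.TTheory GRing.Theory Num.Theory.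
Local Open Scope ring_scope.

(** In terms of Catalan numbers, S_n = sum_j 'C(n + j, 2 j) C_j.  Put h = (p-1)/2
and x = 1/m in F_p.  For j <= h the congruence 'C(2 j + i, i) = (-1)^i 'C(p-1-2 j, i)
turns the inner sum sum_(n < p) 'C(n + j, 2 j) x^n into x^j (1 - x)^(p-1-2 j), while
C_j = 0 for h < j < p-1 and C_(p-1) = -1.  As - 2 C_j = (-4)^(j+1) 'C(h+1, j+1) mod p,
the binomial theorem for ((1 - x)^2 - 4 x)^(h+1) gives, with D = 1 - 6 x + x^2,
  2 x sum_(n < p) S_n x^n = (1 - x)^(p+1) - D^(h+1) - 2 x^p
                          = 1 - 4 x + x^2 - D^(h+1),
and D^h is the Legendre symbol by Euler's criterion. *)

(** * Catalan numbers and the integer form of the Schröder numbers *)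

Definition catalan (k : nat) : nat := ('C(k.*2, k) - 'C(k.*2, k.+1))%N.

Lemma mul_catalan k : (k.+1 * catalan k)%N = 'C(k.*2, k).
Proof.
rewrite /catalan mulnBr mul_bin_left -addnn addnK addnn.
by rewrite -mulnBl subSnn mul1n.
Qed.

(** The subtraction in [catalan] is never truncated, because (k+1) C(2k, k+1) = k C(2k, k). *)
Lemma catalanE k : ('C(k.*2, k.+1) + catalan k)%N = 'C(k.*2, k).
Proof.
have := mul_bin_left k.*2 k; rewrite -{2}addnn addnK /catalan => E.
rewrite subnKC // -(leq_pmul2l (ltn0Sn k)) E.
by rewrite leq_mul2r leqnSn orbT.
Qed.

Lemma catalanS k : (k.+2 * catalan k.+1 = k.*2.+1.*2 * catalan k)%N.
Proof.
apply/eqP; rewrite -(eqn_pmul2l (ltn0Sn k)).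
rewrite mul_catalan mulnCA mul_catalan doubleS.
have E1 := mul_bin_diag k.*2.+2 k.
have E2 := mul_bin_down k.*2.+1 k.
rewrite /= in E1 E2.
have e : (k.*2.+1 - k = k.+1)%N by lia.
rewrite e in E2.
by apply/eqP; nia.
Qed.

(** Free of division, so it maps to characteristic p, where the factor 1/(k+1) of [schroeder] has no
    meaning at k = p-1. *)
Definition schroeder_nat (n : nat) : nat :=
  (\sum_(0 <= k < n.+1) 'C(n + k, k.*2) * catalan k)%N.

(** Termwise: once k+1 is cleared, both products of binomials equal (n+k)! / (k!^2 (n-k)!). *)
Lemma schroederE n : schroeder n = (schroeder_nat n)%:R.
Proof.
rewrite /schroeder /schroeder_nat natr_sum; apply: eq_big_nat => k /andP[_ kn].
have k1 : (k.+1%:R : rat) != 0 by rewrite pnatr_eq0.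
rewrite mul1r -!natrM; apply: (canLR (mulfK k1)); rewrite -natrM; congr (_%:R).
rewrite -mulnA [(catalan k * _)%N]mulnC mul_catalan.
rewrite ltnS in kn.
have k2 : (k.*2 <= n + k)%N by lia.
have E1 := bin_fact kn.
have E2 := bin_fact (leq_addl n k).
have E3 := bin_fact k2.
have k3 : (k <= k.*2)%N by lia.
have E4 := bin_fact k3.
rewrite addnK in E2.
have e3 : (n + k - k.*2 = n - k)%N by lia.
have e4 : (k.*2 - k = k)%N by lia.
rewrite e3 in E3; rewrite e4 in E4.
apply/eqP; rewrite -(eqn_pmul2r (fact_gt0 k)) -(eqn_pmul2r (fact_gt0 k)).
rewrite -(eqn_pmul2r (fact_gt0 (n - k))); apply/eqP.
transitivity ((n + k)`!); first by rewrite -E2 -E1; ring.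
by rewrite -E3 -E4; ring.
Qed.

(** * Binomial and Catalan sums in a field of odd characteristic p *)

Section Characteristic.

Variables (F : fieldType) (p : nat).
Hypothesis pcharFp : p \in [pchar F].

Let p_prime : prime p. Proof. exact: pcharf_prime pcharFp. Qed.

Let p_gt0 : (0 < p)%N. Proof. exact: prime_gt0. Qed.

Lemma natf_neq0_lt n : (0 < n < p)%N -> n%:R != 0 :> F.
Proof. by move=> np; rewrite -(dvdn_pcharf pcharFp) gtnNdvd //; lia. Qed.

(** Induction on i: both sides grow by the same ratio, since a+i+1 = -(b-i) in [F], and i < p lets
    the factor i+1 be cancelled. *)
Lemma binD_pchar a b i : (a + b).+1%:R = 0 :> F -> (i < p)%N ->
  'C(a + i, i)%:R = (-1) ^+ i * 'C(b, i)%:R :> F.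
Proof.
move=> ab0; elim: i => [|i IHi] ip; first by rewrite !bin0 mul1r.
have i1 : i.+1%:R != 0 :> F by apply: natf_neq0_lt.
apply: (mulfI i1); rewrite mulrCA -!natrM addnS -mul_bin_diag mul_bin_left.
rewrite /= !natrM IHi 1?ltnW // exprS.
have [ib|bi] := leqP i b; last by rewrite bin_small //; ring.
have -> : (a + i).+1%:R = - (b - i)%:R :> F.
  apply/eqP; rewrite -addr_eq0 -natrD -ab0; apply/eqP; congr (_%:R).
  by lia.
by ring.
Qed.

Hypothesis p_odd : odd p.

Let h := p./2.

Let pE : p = h.*2.+1. Proof. by rewrite -[LHS](odd_double_half p) p_odd. Qed.

Let h2 : h%:R * 2 = -1 :> F.
Proof.
apply/eqP; rewrite -addr_eq0 -natrM muln2 natr1 -pE.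
by rewrite (pcharf0 pcharFp).
Qed.

(* Modulo p the exponent h.+1 is 1/2, so this is the expansion of
   sqrt (1 - 4 x) = 1 - 2 x C(x). *)
Lemma catalan_pchar j : (j.+1 < p)%N ->
  (-4) ^+ j.+1 * 'C(h.+1, j.+1)%:R = - 2 * (catalan j)%:R :> F.
Proof.
elim: j => [_|j IHj jp].
  have -> : catalan 0 = 1%N by [].
  rewrite bin1 -[h.+1%:R]natr1 expr1.
  have -> : -4 * (h%:R + 1) = -2 * (h%:R * 2) - 4 :> F by ring.
  by rewrite h2; ring.
have j2 : j.+2%:R != 0 :> F by apply: natf_neq0_lt.
apply: (mulfI j2); rewrite mulrCA -natrM mul_bin_left.
rewrite [RHS]mulrCA -natrM catalanS !natrM [RHS]mulrCA -IHj 1?ltnW //.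
rewrite exprS; have [jh|hj] := leqP j h; last by rewrite bin_small //; ring.
rewrite subSS natrB // -muln2 natrM -[j.*2.+1%:R]natr1 -muln2 natrM.
(* As 2h = -1, the factor 2(2j+1) of the Catalan recurrence is -4(h-j), the step from
   ['C(h.+1, j.+1)] to ['C(h.+1, j.+2)]. *)
have -> : j%:R * 2 + 1 = (j%:R - h%:R) * 2 :> F by rewrite mulrBl h2; ring.
by ring.
Qed.

Lemma catalan_pchar0 j : (h < j)%N -> (j.+1 < p)%N -> (catalan j)%:R = 0 :> F.
Proof.
move=> hj jp; have two : - 2 != 0 :> F.
  by rewrite oppr_eq0; apply: natf_neq0_lt; lia.
by apply: (mulfI two); rewrite -catalan_pchar // bin_small // !mulr0.
Qed.

(** The recurrence breaks at this index, where j+1 = p cannot be cancelled. Instead C(2p-2, p-1) is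
    p times the Catalan number, hence 0, which leaves -C(2p-2, p); [binD_pchar] evaluates C(2p-2,
    p-2) as -(p-1) = 1. *)
Lemma catalan_pchar_pred : (catalan p.-1)%:R = -1 :> F.
Proof.
have := catalanE p.-1; rewrite -mul_catalan prednK // => /(congr1 (fun n => n%:R : F)).
rewrite natrM (pcharf0 pcharFp) mul0r natrD => /eqP; rewrite addrC addr_eq0 => /eqP ->.
congr (- _); have h_gt0 : (0 < h)%N by case: h pE p_prime => // ->.
have -> : (p.-1.*2 = p + (p - 2))%N by lia.
rewrite -bin_sub ?leq_addr // addKn (@binD_pchar p p.-1); last by lia.
  have -> : 'C(p.-1, p - 2) = p.-1.
    have -> : (p - 2 = p.-1 - 1)%N by lia.
    by rewrite bin_sub ?bin1 //; lia.
  have -> : (p - 2 = h.-1.*2.+1)%N by lia.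
  rewrite exprS -mul2n exprM sqrrN expr1n expr1n mulr1.
  rewrite -subn1 natrB // (pcharf0 pcharFp); ring.
by rewrite -addnS prednK // natrD (pcharf0 pcharFp) addr0.
Qed.

Lemma sum_bin_pchar j (x : F) : (j <= h)%N ->
  \sum_(0 <= n < p) 'C(n + j, j.*2)%:R * x ^+ n
    = x ^+ j * (1 - x) ^+ (h - j).*2.
Proof.
move=> jh; have jp : (j <= p)%N by lia.
have binE i : (i < p)%N ->
    'C(i + j + j, j.*2)%:R = (-1) ^+ i * 'C((h - j).*2, i)%:R :> F.
  move=> ip; have -> : (i + j + j = j.*2 + i)%N by lia.
  rewrite -bin_sub ?leq_addr // addKn; apply: binD_pchar => //.
  by rewrite -doubleD subnKC // -pE (pcharf0 pcharFp).
(* Terms with n < j vanish; the others are reindexed by n = i + j. *)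
rewrite (big_cat_nat (leq0n _) jp) //= big_nat_cond big1 ?add0r; last first.
  by move=> n /andP[/andP[_ nj] _]; rewrite bin_small ?mul0r //; lia.
rewrite -{1}[j]add0n big_addn exprBn -(big_mkord xpredT (fun i =>
  (-1) ^+ i * 1 ^+ ((h - j).*2 - i) * x ^+ i *+ 'C((h - j).*2, i))).
(* Past i = 2(h-j) the binomials vanish, so the range is cut to that of the binomial theorem. *)
have bp : ((h - j).*2.+1 <= p - j)%N by lia.
rewrite (big_cat_nat (leq0n _) bp) //= [X in _ + X]big_nat_cond.
rewrite [X in _ + X]big1 ?addr0.
  rewrite mulr_sumr; apply: eq_big_nat => i /andP[_ ib].
  by rewrite binE ?expr1n ?exprD -1?mulr_natr; [ring|lia].
move=> i /andP[/andP[bi ip] _].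
by rewrite binE ?bin_small ?mulr0 ?mul0r //; lia.
Qed.

(** Letting j run up to p-1 for every n adds only zeros, since C(n+j, 2j) = 0 for j > n; the two
    sums can then be exchanged. *)
Lemma sum_schroeder_catalan (x : F) :
  \sum_(0 <= n < p) (schroeder_nat n)%:R * x ^+ n
    = \sum_(0 <= j < p) (catalan j)%:R
        * \sum_(0 <= n < p) 'C(n + j, j.*2)%:R * x ^+ n.
Proof.
under [RHS]eq_bigr do rewrite mulr_sumr.
rewrite exchange_big_nat; apply: eq_big_nat => n /andP[_ np].
rewrite (big_cat_nat (leq0n _) np) //= [X in _ = _ + X]big_nat_cond.
rewrite [X in _ = _ + X]big1 ?addr0.
  rewrite natr_sum mulr_suml; apply: eq_big_nat => j _.
  by rewrite natrM; ring.
by move=> j /andP[/andP[nj _] _]; rewrite bin_small ?mul0r ?mulr0 //; lia.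
Qed.

Lemma sum_schroeder_pchar (x : F) : x ^+ p = x ->
  2 * x * \sum_(0 <= n < p) (schroeder_nat n)%:R * x ^+ n
    = 1 - 4 * x + x ^+ 2 - (1 - 6 * x + x ^+ 2) ^+ h.+1.
Proof.
move=> xp; rewrite sum_schroeder_catalan.
have h_gt0 : (0 < h)%N by case: h pE p_prime => // ->.
rewrite -{1}(prednK p_gt0) big_nat_recr //= mulrDr.
(* In the inner sum for j = p-1 only n = p-1 survives. *)
have -> : \sum_(0 <= n < p) 'C(n + p.-1, p.-1.*2)%:R * x ^+ n = x ^+ p.-1.
  rewrite -{1}(prednK p_gt0) big_nat_recr //= addnn binn mul1r.
  rewrite big_nat_cond big1 ?add0r // => n /andP[/andP[_ np] _].
  by rewrite bin_small ?mul0r //; lia.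
have hp : (h.+1 <= p.-1)%N by lia.
rewrite (big_cat_nat (leq0n _) hp) //= [X in _ * (_ + X)]big_nat_cond.
rewrite [X in _ * (_ + X)]big1 ?addr0; last first.
  by move=> j /andP[/andP[hj jp] _]; rewrite catalan_pchar0 ?mul0r //; lia.
rewrite catalan_pchar_pred mulN1r mulrN -[2 * x * x ^+ _]mulrA -exprS prednK // xp.
have -> : 1 - 6 * x + x ^+ 2 = (1 - x) ^+ 2 + (-4 * x) by ring.
rewrite exprDn -(big_mkord xpredT (fun i =>
  ((1 - x) ^+ 2) ^+ (h.+1 - i) * (-4 * x) ^+ i *+ 'C(h.+1, i))).
rewrite [\sum_(0 <= i < h.+2) _]big_nat_recl //= subn0 bin0 mulr1 mulr1n -exprM.
(* The exponent is p+1, and Frobenius with x^p = x gives (1-x)^p = 1-x. *)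
have -> : (1 - x) ^+ (2 * h.+1) = (1 - x) ^+ 2.
  have -> : (2 * h.+1 = p.+1)%N by lia.
  rewrite exprSr -(pFrobenius_autE pcharFp) rmorphB rmorph1 /=.
  by rewrite pFrobenius_autE xp.
rewrite mulr_sumr.
(* With the constant term removed, binomial index i+1 corresponds to Catalan index i. *)
suff -> : \sum_(0 <= i < h.+1) ((1 - x) ^+ 2) ^+ (h.+1 - i.+1)
    * (-4 * x) ^+ i.+1 *+ 'C(h.+1, i.+1)
  = - \sum_(0 <= i < h.+1) 2 * x * ((catalan i)%:R *
     \sum_(0 <= n < p) 'C(n + i, i.*2)%:R * x ^+ n) by ring.
rewrite -sumrN; apply: eq_big_nat => j /andP[_ jh].
rewrite sum_bin_pchar // subSS -exprM mul2n exprMn -mulr_natr.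
have -> : forall a b c d : F, a * (b * c) * d = a * c * (b * d) by move=> *; ring.
by rewrite catalan_pchar ?exprS; [ring|lia].
Qed.

End Characteristic.

(** * Fermat's theorem and Euler's criterion in ['F_p] *)

Lemma Fp_fermat p (x : 'F_p) : prime p -> x ^+ p = x.
Proof. by move=> p_prime; have := expf_card x; rewrite card_Fp. Qed.

(** The unit group is cyclic: if a = z^i with z a generator, the hypothesis makes p-1 = 2h divide i
    h, so i is even and z^(i/2) is a root. *)
Lemma Fp_euler_square p (a : 'F_p) : prime p -> odd p ->
  a ^+ p./2 = 1 -> exists y, y ^+ 2 = a.
Proof.
move=> p_prime p_odd aE.
have p_gt2 : (2 < p)%N by case: p p_prime p_odd {a aE} => [|[|[]]].
have p1_gt0 : (0 < p.-1)%N by rewrite ltn_predRL ltnW.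
pose rs := [seq x <- enum 'F_p | x != 0].
have unity (x : 'F_p) : x != 0 -> x ^+ p.-1 = 1.
  move=> x0; apply: (mulfI x0).
  by rewrite -exprS prednK ?mulr1 ?Fp_fermat // prime_gt0.
have rs_unity : all p.-1.-unity_root rs.
  by apply/allP => x; rewrite mem_filter => /andP[x0 _]; apply/unity_rootP/unity.
have rs_size : (p.-1 <= size rs)%N.
  have -> : size rs = count (predC (pred1 0)) (enum 'F_p) by rewrite size_filter.
  have := card_Fp p_prime.
  rewrite cardE -(count_predC (pred1 0)) (count_uniq_mem _ (enum_uniq _)).
  by rewrite mem_enum add1n => /(congr1 predn) /= ->.
have /hasP[z _ zP] := has_prim_root p1_gt0 rs_unity
  (filter_uniq _ (enum_uniq _)) rs_size.
have h_gt0 : (0 < p./2)%N by rewrite half_gt0 ltnW.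
have a0 : a != 0.
  by apply: contra_eq_neq aE => ->; rewrite expr0n gtn_eqF // eq_sym oner_neq0.
have [[i _] /= ai] := prim_rootP zP (unity a a0).
exists (z ^+ i./2); rewrite ai -exprM muln2; congr (z ^+ _).
apply: even_halfK.
have : (p.-1 %| i * p./2)%N by rewrite (prim_order_dvd zP) exprM -ai aE.
have -> : p.-1 = (2 * p./2)%N by rewrite mul2n odd_halfK.
by rewrite dvdn_pmul2r // dvdn2.
Qed.

Lemma legendre_euler p (a : int) : prime p -> odd p ->
  (legendre a p)%:~R = a%:~R ^+ p./2 :> 'F_p.
Proof.
move=> p_prime p_odd; have pcharFp := pchar_Fp p_prime.
have h_gt0 : (0 < p./2)%N by case: p p_prime p_odd {pcharFp} => [|[|[]]].
have sqr_half (y : 'F_p) : y != 0 -> (y ^+ 2) ^+ p./2 = 1.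
  move=> y0; apply: (mulfI y0); rewrite -exprM mul2n odd_halfK // -exprS.
  by rewrite prednK ?prime_gt0 // mulr1 Fp_fermat.
rewrite /legendre (dvdz_pcharf pcharFp).
have [->|a0] := eqVneq (a%:~R : 'F_p) 0; first by rewrite expr0n gtn_eqF.
case: existsP => [[x]|nsq].
  rewrite eqz_mod_dvd (dvdz_pcharf pcharFp) rmorphB rmorphXn /= subr_eq0.
  move=> /eqP xa; rewrite -xa sqr_half //.
  by apply: contra_neq a0 => x0; rewrite -xa x0 expr0n.
(* The power is 1 or -1; the value 1 would yield a square root, whose representative below p
   contradicts [nsq]. *)
have : (a%:~R ^+ p./2) ^+ 2 == 1 :> 'F_p by rewrite exprAC sqr_half.
rewrite sqrf_eq1 => /orP[/eqP aE|/eqP->]; last by rewrite rmorphN1.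
have [y ya] := Fp_euler_square p a%:~R p_prime p_odd aE.
have yp : (y < p)%N by rewrite -[ltnRHS](Fp_cast p_prime) ltn_ord.
case: nsq; exists (Ordinal yp).
rewrite eqz_mod_dvd (dvdz_pcharf pcharFp) rmorphB rmorphXn /= subr_eq0.
by rewrite -pmulrn natr_Zp ya.
Qed.

(** * Congruences between fractions, and the final computation *)

Lemma p_integral_frac p (a b : int) :
  prime p -> ~~ (p %| b)%Z -> p_integral p (a%:~R / b%:~R).
Proof.
(* The reduced denominator divides b, so p cannot divide it; b = 0 is excluded because p divides
   0. *)
move=> p_prime; rewrite /p_integral; case: divqP => [|k x _].
  by rewrite dvdz0.
rewrite coprime_sym prime_coprime //; apply: contra => px.
by rewrite dvdz_mull.
Qed.

Lemma rat_eqmod_frac p (a b c d : int) :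
    prime p -> ~~ (p %| b)%Z -> ~~ (p %| d)%Z -> (p %| a * d - c * b)%Z ->
  rat_eqmod p (a%:~R / b%:~R) (c%:~R / d%:~R).
Proof.
move=> p_prime pb pd /dvdzP[q E]; split; try exact: p_integral_frac.
have nz e : ~~ (p %| e)%Z -> e%:~R != 0 :> rat.
  by rewrite intr_eq0; apply: contraNneq => ->.
(* The difference of the fractions is (ad - cb)/(bd), and ad - cb = q p. *)
exists (q%:~R / (b * d)%:~R).
  apply: p_integral_frac => //.
  by rewrite dvdzE abszM Euclid_dvdM // negb_or; apply/andP.
rewrite -mulNr addf_div ?nz // mulNr -!rmorphM -rmorphB E /=.
by rewrite [(q * _)%:~R]intrM [q%:~R * _]mulrC mulrA.
Qed.

Theorem theorem1p2 (p : nat) (m : int)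
    (p_prime : prime p) (p_odd : odd p) (p_ndvd_m : ~~ (p %| m)%Z) :
  rat_eqmod p
    (\sum_(1 <= k < p) schroeder k / m%:~R ^+ k)
    ((m ^+ 2 - 6 * m + 1)%:~R / (2 * m%:~R)
       * (1 - (legendre (m ^+ 2 - 6 * m + 1) p)%:~R)).
Proof.
have pcharFp := pchar_Fp p_prime; have p_gt0 := prime_gt0 p_prime.
set d := m ^+ 2 - 6 * m + 1; set l := legendre d p.
have m0 : m%:~R != 0 :> rat.
  by rewrite intr_eq0; apply: contraNneq p_ndvd_m => ->.
have u0 : m%:~R != 0 :> 'F_p by rewrite -(dvdz_pcharf pcharFp).
have two0 : 2 != 0 :> 'F_p.
  rewrite -(dvdn_pcharf pcharFp) gtnNdvd //.
  by case: p p_prime p_odd {p_ndvd_m pcharFp p_gt0 l u0} => [|[|[]]].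
(* [A] is the numerator of the sum over the common denominator m^(p-1), which is 1 modulo p. *)
pose A : int := \sum_(1 <= k < p) (schroeder_nat k)%:Z * m ^+ (p.-1 - k).
have -> : \sum_(1 <= k < p) schroeder k / m%:~R ^+ k
    = A%:~R / (m ^+ p.-1)%:~R :> rat.
  rewrite rmorph_sum /= mulr_suml; apply: eq_big_nat => k /andP[_ kp].
  have kp' : (k <= p.-1)%N by rewrite -ltnS prednK.
  rewrite schroederE rmorphM !rmorphXn /= -pmulrn -{2}(subnK kp') exprD invfM.
  by rewrite mulrA mulfK // expf_neq0.
have -> : d%:~R / (2 * m%:~R) * (1 - l%:~R)
    = (d * (1 - l))%:~R / (2 * m)%:~R :> rat.
  by rewrite !rmorphM rmorphB /= mulrAC.
apply: rat_eqmod_frac => //.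
- by rewrite (dvdz_pcharf pcharFp) rmorphXn expf_neq0.
- by rewrite (dvdz_pcharf pcharFp) rmorphM mulf_neq0.
rewrite (dvdz_pcharf pcharFp) rmorphB !rmorphM rmorphB rmorphXn /=.
rewrite legendre_euler //.
set u : 'F_p := m%:~R; set v : 'F_p := d%:~R.
have up : u ^+ p.-1 = 1.
  by apply: (mulfI u0); rewrite -exprS prednK // Fp_fermat // mulr1.
pose x := u^-1; have xu : u * x = 1 by rewrite mulfV.
pose T := \sum_(1 <= k < p) (schroeder_nat k)%:R * x ^+ k.
have -> : A%:~R = T.
  rewrite rmorph_sum /=; apply: eq_big_nat => k /andP[_ kp].
  have kp' : (k <= p.-1)%N by rewrite -ltnS prednK.
  rewrite rmorphM rmorphXn /= -pmulrn; congr (_ * _).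
  have uk : u ^+ k != 0 by rewrite expf_neq0.
  by apply: (mulIf uk); rewrite -exprD subnK // up -exprMn mulrC xu expr1n.
have := sum_schroeder_pchar _ _ pcharFp p_odd x (Fp_fermat _ _ p_prime).
have vE : 1 - 6 * x + x ^+ 2 = x ^+ 2 * v.
  rewrite /x /v rmorphD rmorphB rmorphXn rmorphM rmorph1 /= -/u.
  by field.
(* [T] starts at k = 1, so the full sum is 1 + [T], as S_0 = 1. *)
rewrite vE big_ltn // -/T.
have -> : schroeder_nat 0 = 1%N by rewrite /schroeder_nat big_nat1.
rewrite [_ ^+ p./2.+1]exprS exprMn -[(x ^+ 2) ^+ _]exprM mul2n odd_halfK //.
rewrite [x ^+ p.-1]exprVn up invr1 expr0 !mul1r => E.
apply/eqP; have x0 : x ^+ 2 != 0 by rewrite expf_neq0 // invr_eq0.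
apply: (mulfI x0).
(* The factors u x = 1 are kept so that the left side of [E] appears. *)
transitivity (u * x * (2 * x * (1 + T)) - 2 * x * (u * x)
  - x ^+ 2 * v + x ^+ 2 * v * v ^+ p./2); first by ring.
by rewrite E xu -vE; ring.
Qed.
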